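(* Let $\mathcal{X}$ be a finite non-empty set, let $\omega\in\mathcal{X}^{\mathbb{N}}$ be a path and let $\underline{E}$ be a coherent lower expectation on $\mathcal{L}(\mathcal{X})$. If $\omega$ is computably random for $\underline{E}$, then $\omega$ is also computably random for every coherent lower expectation $\underline{E}'$ on $\mathcal{L}(\mathcal{X})$ such that $\underline{E}'(f)\le\underline{E}(f)$ for every gamble $f\in\mathcal{L}(\mathcal{X})$.
   Context: A gamble is a map $f:\mathcal{X}\to\mathbb{R}$; $\mathcal{L}(\mathcal{X})$ is the linear space of all gambles. A coherent lower expectation is a map $\underline{E}:\mathcal{L}(\mathcal{X})\to\mathbb{R}$ such that for all $f,g\in\mathcal{L}(\mathcal{X})$ and real $\alpha\ge 0$: $\min f\le\underline{E}(f)$; $\underline{E}(\alpha f)=\alpha\underline{E}(f)$; $\underline{E}(f)+\underline{E}(g)\le\underline{E}(f+g)$. Its conjugate upper expectation is $\overline{E}(f):=-\underline{E}(-f)$. Situations are the finite sequences $s=x_{1:n}=(x_1,\dots,x_n)\in\mathbb{S}:=\bigcup_{n\in\mathbb{N}_0}\mathcal{X}^n$, with $\square$ the empty sequence; $sx$ is the concatenation of $s\in\mathbb{S}$ and $x\in\mathcal{X}$. For a path $\omega=(x_1,x_2,\dots)\in\mathcal{X}^{\mathbb{N}}$, $\omega^n:=(x_1,\dots,x_n)$ for $n\in\mathbb{N}_0$. A real process is a map $F:\mathbb{S}\to\mathbb{R}$; its process difference is the gamble $\Delta F(s)$ given by $\Delta F(s)(x):=F(sx)-F(s)$. A net of rationals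 $\{r_{s,n}\}_{s\in\mathbb{S},n\in\mathbb{N}_0}$ is recursive if $r_{s,n}=(-1)^{\sigma(s,n)}a(s,n)/b(s,n)$ for some recursive (Turing-computable) maps $a,b,\sigma:\mathbb{S}\times\mathbb{N}_0\to\mathbb{N}_0$ with $b$ nowhere zero. A real process $F$ is computable if there is a recursive net of rationals $\{r_{s,n}\}$ with $|r_{s,n}-F(s)|\le 2^{-N}$ for all $s\in\mathbb{S}$ and all $n\ge N$ in $\mathbb{N}_0$. A path $\omega$ is computably random for a coherent lower expectation $\underline{E}$ if there is no computable real process $M$ with $M(s)\ge 0$ and $\overline{E}(\Delta M(s))\le 0$ for all $s\in\mathbb{S}$ such that $\sup_{n\in\mathbb{N}_0}M(\omega^n)=+\infty$. *)

(* Defs.v *)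
From mathcomp Require Import all_boot all_order all_algebra.
From mathcomp Require Import all_classical all_reals ereal.

Set Implicit Arguments.
Unset Strict Implicit.
Unset Printing Implicit Defensive.

Import Order.TTheory GRing.Theory Num.Theory.
Local Open Scope classical_set_scope.
Local Open Scope ring_scope.

Inductive direction := MoveLeft | MoveStay | MoveRight.

Definition displacement (d : direction) : int :=
  match d with MoveLeft => -1 | MoveStay => 0 | MoveRight => 1 end.

(* Deterministic Turing machines with one two-way infinite tape and input     *)
(* alphabet A. The machine may use further letters tm_work; a cell holds a    *)
(* letter (Some) or is blank (None). The machine halts when no transition is  *)
(* specified.                                                                 *)
Record turing_machine (A : finType) := TuringMachine {
  tm_state : finType;
  tm_work : finType;
  tm_start : tm_state;
  tm_trans : tm_state -> option (A + tm_work) ->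
             option (tm_state * option (A + tm_work) * direction)
}.

Section Execution.
Variables (A : finType) (T : turing_machine A).

Definition cell := option (A + tm_work T).

Record config := Config {
  cf_state : tm_state T;
  cf_head : int;
  cf_tape : int -> cell
}.

Definition tm_step (c : config) : option config :=
  if tm_trans (cf_state c) (cf_tape c (cf_head c)) is Some (q, y, d) then
    Some (Config q (cf_head c + displacement d)
            (fun j => if j == cf_head c then y else cf_tape c j))
  else None.

Definition word_tape (u : seq A) (j : int) : cell :=
  if j is Posz i then omap inl (onth u i) else None.

Definition tm_init (u : seq A) : config :=
  Config (tm_start T) 0 (word_tape u).

(* Started at the first letter of u on an otherwise blank tape, T halts at    *)
(* the first letter of v on an otherwise blank tape.                          *)
Definition tm_outputs (u v : seq A) : Prop :=
  exists (k : nat) (c : config),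
    [/\ iter k (obind tm_step) (Some (tm_init u)) = Some c,
        tm_step c = None
      & forall j : int, cf_tape c (cf_head c + j) = word_tape v j].

End Execution.

(* Letters on the tape: elements of X, a tally mark inr true for writing      *)
(* natural numbers in unary, and a separator inr false.                       *)
Definition unary (X : finType) (n : nat) : seq (X + bool)%type :=
  nseq n (inr true).

Definition encode_input (X : finType) (s : seq X) (n : nat) :
    seq (X + bool)%type :=
  map inl s ++ inr false :: unary X n.

Definition recursive (X : finType) (h : seq X -> nat -> nat) : Prop :=
  exists T : turing_machine (X + bool)%type,
    forall s n, tm_outputs T (encode_input s n) (unary X (h s n)).

Definition recursive_net (X : finType) (r : seq X -> nat -> rat) : Prop :=
  exists a b sigma : seq X -> nat -> nat,
    [/\ recursive a, recursive b, recursive sigma,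
        forall s n, b s n <> 0%N
      & forall s n, r s n = (-1) ^+ sigma s n * ((a s n)%:R / (b s n)%:R)].

Section Randomness.
Variables (R : realType) (X : finType).

(* The minimum is taken in \bar R, where +oo is the neutral element of mine;  *)
(* for nonempty X it is the real number min f.                                *)
Definition coherent_lower_expectation (E : (X -> R) -> R) : Prop :=
  [/\ forall f : X -> R, (\big[mine/+oo]_(x : X) (f x)%:E <= (E f)%:E)%E,
      forall (f : X -> R) (a : R), 0 <= a -> E (fun x => a * f x) = a * E f
    & forall f g : X -> R, E f + E g <= E (f \+ g)].

Definition conjugate_upper (E : (X -> R) -> R) (f : X -> R) : R := - E (\- f).

Definition process_difference (F : seq X -> R) (s : seq X) : X -> R :=
  fun x => F (rcons s x) - F s.

Definition computable (F : seq X -> R) : Prop :=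
  exists r : seq X -> nat -> rat, recursive_net r /\
    forall (s : seq X) (N n : nat), (N <= n)%N ->
      `|ratr (r s n) - F s| <= 2 ^- N.

(* omega i is the (i+1)-st entry of the path. *)
Definition path_prefix (omega : nat -> X) (n : nat) : seq X := mkseq omega n.

Definition computably_random (E : (X -> R) -> R) (omega : nat -> X) : Prop :=
  ~ exists M : seq X -> R,
      [/\ computable M,
          forall s, 0 <= M s,
          forall s, conjugate_upper E (process_difference M s) <= 0
        & ereal_sup [set (M (path_prefix omega n))%:E | n in [set: nat]] = +oo%E].

End Randomness.

(* Main.v *)
Require Import Defs.
From mathcomp Require Import all_boot all_order all_algebra.
From mathcomp Require Import all_classical all_reals.
Import Order.TTheory GRing.Theory Num.Theory.
Local Open Scope ring_scope.

Theorem corollary13 (R : realType) (X : finType) (hX : (0 < #|X|)%N)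
    (omega : nat -> X) (E : (X -> R) -> R) (hE : coherent_lower_expectation E) :
  computably_random E omega ->
  forall E' : (X -> R) -> R,
    coherent_lower_expectation E' -> (forall f : X -> R, E' f <= E f) ->
    computably_random E' omega.
Proof.
move=> omega_rand E' _ leE'E [M [compM M_ge0 superM supM]].
(* A process [M] that defeats [omega] for [E'] also defeats it for [E]: of the four conditions, only
   the supermartingale inequality depends on the expectation. *)
apply: omega_rand; exists M; split=> // s.
(* Conjugation reverses the order: [E' <= E] at the negated difference bounds the upper expectation
   of [E] by that of [E'], so a supermartingale for [E'] is one for [E]. *)
by apply: le_trans (superM s); rewrite /conjugate_upper lerN2 leE'E.
Qed.
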